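(* Let $A \in \mathbb{R}^{n\times n}$, $L \in \mathbb{R}^{n \times q}$, $C \in \mathbb{R}^{p \times n}$, and let $L_i$ denote the $i$th column of $L$. The FDI problem for $(A,L,C)$ is solvable if and only if the index $d_i$ of $(A,L_i,C)$ exists for all $i=1,2,\ldots,q$ and the matrix $$R := \begin{bmatrix} CA^{d_1-1}L_1 & CA^{d_2-1}L_2 & \cdots & CA^{d_q-1}L_q\end{bmatrix}$$ has full column rank.
   Context: $(A,L,C)$ denotes the linear time-invariant system $\dot x = Ax+Lf$, $y=Cx$ with state $x\in\mathbb{R}^n$, fault $f\in\mathbb{R}^q$, output $y\in\mathbb{R}^p$. Solvability of the FDI (fault detection and isolation) problem: for $G\in\mathbb{R}^{n\times p}$ let $\mathcal{V}_i$ be the smallest $(A+GC)$-invariant subspace of $\mathbb{R}^n$ containing $\operatorname{im} L_i$, $i=1,\ldots,q$. The FDI problem for $(A,L,C)$ is solvable if there exists $G\in\mathbb{R}^{n\times p}$ such that the family $\{C\mathcal{V}_i\}_{i=1}^q$ is independent, meaning that $C\mathcal{V}_i\neq\{0\}$ and $C\mathcal{V}_i\cap\big(\sum_{j\neq i}C\mathcal{V}_j\big)=\{0\}$ for all $i=1,\ldots,q$. Index: with $A^0:=I$, the index of $(A,L_i,C)$ is the positive integer $d_i$ (if it exists) such that $CA^jL_i=0$ for $j=0,1,\ldots,d_i-2$ and $CA^{d_i-1}L_i\neq 0$. If no such positive integer exists, the index is said not to exist. *)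

(* Defs.v *)
From mathcomp Require Import all_boot all_order all_algebra.
From mathcomp Require Import reals.

Set Implicit Arguments.
Unset Strict Implicit.
Unset Printing Implicit Defensive.

Import Order.TTheory GRing.Theory Num.Theory.
Local Open Scope ring_scope.

(* Vectors are columns, so a matrix [M] acts by [v |-> M *m v]. *)
Definition mxact (R : realType) (m n : nat) (M : 'M[R]_(m, n)) :
    'Hom('cV[R]_n, 'cV[R]_m) :=
  linfun (mulmx M).

Lemma mxactE (R : realType) (m n : nat) (M : 'M[R]_(m, n)) (v : 'cV[R]_n) :
  mxact M v = M *m v.
Proof. exact: lfunE. Qed.

Definition mx_invariant (R : realType) (n : nat) (M : 'M[R]_n)
    (V : {vspace 'cV[R]_n}) : Prop :=
  (mxact M @: V <= V)%VS.

Definition smallest_invariant (R : realType) (n : nat) (M : 'M[R]_n)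
    (U V : {vspace 'cV[R]_n}) : Prop :=
  [/\ mx_invariant M V,
      (U <= V)%VS
    & forall W : {vspace 'cV[R]_n},
        mx_invariant M W -> (U <= W)%VS -> (V <= W)%VS].

(* The two lemmas below make "the smallest invariant subspace" meaningful, so
   that it may be introduced existentially in [FDI_solvable]. *)
Lemma smallest_invariant_uniq (R : realType) (n : nat) (M : 'M[R]_n)
    (U V V' : {vspace 'cV[R]_n}) :
  smallest_invariant M U V -> smallest_invariant M U V' -> V = V'.
Proof.
move=> [iV UV minV] [iV' UV' minV']; apply: subv_anti.
by rewrite minV ?minV'.
Qed.

Lemma smallest_invariant_exists (R : realType) (n : nat) (M : 'M[R]_n)
    (U : {vspace 'cV[R]_n}) :
  exists V : {vspace 'cV[R]_n}, smallest_invariant M U V.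
Proof.
pose f (W : {vspace 'cV[R]_n}) := (U + mxact M @: W)%VS.
pose K k := iter k f 0%VS.
have fS W W' : (W <= W')%VS -> (f W <= f W')%VS.
  by move=> sWW'; apply: addvS => //; apply: limgS.
have KS k : (K k <= K k.+1)%VS.
  by elim: k => [|k IHk]; [apply: sub0v | apply: fS].
have Kmin k W : mx_invariant M W -> (U <= W)%VS -> (K k <= W)%VS.
  move=> iW UW; elim: k => [|k IHk]; first exact: sub0v.
  by rewrite /K /= subv_add UW (subv_trans (limgS _ IHk)).
have [k Kk] : exists k, (K k.+1 <= K k)%VS.
  suff: forall m, (exists k, (K k.+1 <= K k)%VS) \/ (m <= \dim (K m))%N.
    case/(_ (\dim {:'cV[R]_n}).+1) => // /leq_trans/(_ (dimvS (subvf _))).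
    by rewrite ltnn.
  elim=> [|m [?|IHm]]; [by right | by left|].
  have [le_m|] := boolP (K m.+1 <= K m)%VS; first by left; exists m.
  move=> nle; right; apply: (leq_ltn_trans IHm).
  rewrite (ltn_leqif (dimv_leqif_sup (KS m))); exact: nle.
have := Kk; rewrite {1}/K /= subv_add => /andP[UK iK].
by exists (K k); split=> // W; apply: Kmin.
Qed.

Definition independent_family (R : realType) (p q : nat)
    (W : 'I_q -> {vspace 'cV[R]_p}) : Prop :=
  forall i : 'I_q,
    W i <> 0%VS /\ (W i :&: \sum_(j < q | j != i) W j)%VS = 0%VS.

Definition FDI_solvable (R : realType) (n p q : nat)
    (A : 'M[R]_n) (L : 'M[R]_(n, q)) (C : 'M[R]_(p, n)) : Prop :=
  exists (G : 'M[R]_(n, p)) (V : 'I_q -> {vspace 'cV[R]_n}),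
    (forall i : 'I_q,
       smallest_invariant (A + G *m C) (limg (mxact (col i L))) (V i)) /\
    independent_family (fun i => mxact C @: V i)%VS.

(* [j < d.-1] is [j <= d - 2], an empty range when [d = 1]. *)
Definition is_index (R : realType) (n p : nat)
    (A : 'M[R]_n) (b : 'cV[R]_n) (C : 'M[R]_(p, n)) (d : nat) : Prop :=
  [/\ (0 < d)%N,
      forall j : nat, (j < d.-1)%N -> C *m A ^+ j *m b = 0
    & C *m A ^+ d.-1 *m b <> 0].

Lemma is_index_uniq (R : realType) (n p : nat)
    (A : 'M[R]_n) (b : 'cV[R]_n) (C : 'M[R]_(p, n)) (d d' : nat) :
  is_index A b C d -> is_index A b C d' -> d = d'.
Proof.
move=> [d_gt0 zd nzd] [d'_gt0 zd' nzd'].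
rewrite -(prednK d_gt0) -(prednK d'_gt0); congr _.+1.
by case: (ltngtP d.-1 d'.-1) => // [/zd'|/zd].
Qed.

Definition fault_matrix (R : realType) (n p q : nat)
    (A : 'M[R]_n) (L : 'M[R]_(n, q)) (C : 'M[R]_(p, n))
    (d : 'I_q -> nat) : 'M[R]_(p, q) :=
  \matrix_(i < p, j < q) (C *m A ^+ (d j).-1 *m col j L) i 0.

(* Main.v *)
Require Import Defs.
From mathcomp Require Import all_boot all_order all_algebra.
From mathcomp Require Import reals.
From mathcomp Require Import boolp.

Import GRing.Theory.
Local Open Scope ring_scope.

(** Output injection does not change the Markov parameters [C A^k b] up to and
    including the first nonzero one.  Hence each [C V_i] contains the [i]-th
    column of the fault matrix, whatever [G] is, which gives necessity.
    For sufficiency, let [Q] be a left inverse of the fault matrix and let [G]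
    send its [i]-th column to [- A^(d_i) L_i]: then [(A + G C)^(d_i) L_i = 0],
    so that [C V_i] is exactly the line spanned by that column. *)

Section OutputInjection.
Set Implicit Arguments.
Unset Strict Implicit.
Variable R : realType.

Lemma limg_mxact_col (n : nat) (b : 'cV[R]_n) : limg (mxact b) = <[b]>%VS.
Proof.
apply/eqP; rewrite eqEsubv; apply/andP; split.
  apply/subvP => _ /memv_imgP[u _ ->]; apply/vlineP; exists (u 0 0).
  by rewrite mxactE [u in LHS]mx11_scalar mul_mx_scalar.
rewrite -memvE; apply/memv_imgP; exists 1%:M; first exact: memvf.
by rewrite mxactE mulmx1.
Qed.

Lemma memv_invariant_pow (n : nat) (M : 'M[R]_n) (V : {vspace 'cV[R]_n})
    (b : 'cV[R]_n) (k : nat) :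
  mx_invariant M V -> b \in V -> M ^+ k *m b \in V.
Proof.
move=> iV bV; elim: k => [|k IHk]; first by rewrite expr0 mul1mx.
rewrite exprS -mulmxE -mulmxA -mxactE.
exact: (subvP iV) (memv_img _ IHk).
Qed.

(* Replacing [W] by [W :&: M^-1 W] keeps the orbit inside and lowers the
   dimension as long as [W] is not invariant. *)
Lemma invariant_sub_orbit (n : nat) (M : 'M[R]_n) (b : 'cV[R]_n)
    (W : {vspace 'cV[R]_n}) :
  (forall k, M ^+ k *m b \in W) ->
  exists2 V : {vspace 'cV[R]_n}, mx_invariant M V & (b \in V) && (V <= W)%VS.
Proof.
have [m] := ubnP (\dim W); elim: m W => // m IHm W leWm orbW.
have bW : b \in W by have := orbW 0; rewrite expr0 mul1mx.
have [iW|niW] := boolP (mxact M @: W <= W)%VS.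
  by exists W; rewrite ?bW ?subvv.
have sW : (W :&: mxact M @^-1: W <= W)%VS by apply: capvSl.
have [||V iV /andP[bV sV]] := IHm (W :&: mxact M @^-1: W)%VS.
- rewrite ltnS in leWm; apply: leq_trans leWm.
  rewrite (ltn_leqif (dimv_leqif_sup sW)); apply: contra niW => /subvP sWW.
  apply/subvP => _ /memv_imgP[u /sWW uW ->].
  by move: uW; rewrite memv_cap -memv_preim => /andP[].
- move=> k; rewrite memv_cap orbW -memv_preim mxactE mulmxA mulmxE -exprS.
  exact: orbW.
by exists V => //; rewrite bV (subv_trans sV sW).
Qed.

(** This reduces bounds on [V] to checks on the orbit of [b]. It is applied with [W] the kernel of
    [C] or the preimage of a line under [C], subspaces that are in general not invariant under
    [M]. *)
Lemma smallest_invariant_sub_orbit (n : nat) (M : 'M[R]_n) (b : 'cV[R]_n)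
    (V W : {vspace 'cV[R]_n}) :
  smallest_invariant M (limg (mxact b)) V ->
  (forall k, M ^+ k *m b \in W) -> (V <= W)%VS.
Proof.
move=> [_ _ minV] /invariant_sub_orbit[V' iV' /andP[bV' sV'W]].
by apply: subv_trans sV'W; apply: minV => //; rewrite limg_mxact_col -memvE.
Qed.

Lemma mem_smallest_invariant (n : nat) (M : 'M[R]_n) (b : 'cV[R]_n)
    (V : {vspace 'cV[R]_n}) (k : nat) :
  smallest_invariant M (limg (mxact b)) V -> M ^+ k *m b \in V.
Proof.
move=> [iV bV _]; apply: memv_invariant_pow => //.
by rewrite memvE -limg_mxact_col.
Qed.

(** One more application of [A + G *m C] to [A ^+ k *m b] adds only [G *m (C *m A ^+ k *m b)], which
    vanishes as long as the Markov parameters do. *)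
Lemma output_injection_pow (n p : nat) (A : 'M[R]_n) (G : 'M[R]_(n, p))
    (C : 'M[R]_(p, n)) (b : 'cV[R]_n) (k : nat) :
  (forall j, (j < k)%N -> C *m A ^+ j *m b = 0) ->
  (A + G *m C) ^+ k *m b = A ^+ k *m b.
Proof.
elim: k => [|k IHk] zC; first by rewrite !expr0.
rewrite !exprS -!mulmxE -!mulmxA IHk; last by move=> j /ltnW/zC.
by rewrite mulmxDl -mulmxA [C *m _]mulmxA zC // mulmx0 addr0.
Qed.

Lemma index_exists (n p : nat) (A : 'M[R]_n) (b : 'cV[R]_n)
    (C : 'M[R]_(p, n)) :
  ~ (forall j, C *m A ^+ j *m b = 0) -> exists d, is_index A b C d.
Proof.
move=> /existsNP[j /eqP nzj].
have exP : exists j, C *m A ^+ j *m b != 0 by exists j.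
case: (ex_minnP exP) => k /eqP nzk mink; exists k.+1; split=> // i /= ltik.
by apply/eqP; apply: contraTT ltik => /mink; rewrite -leqNgt.
Qed.

Lemma output_injection_index (n p : nat) (A : 'M[R]_n) (G : 'M[R]_(n, p))
    (C : 'M[R]_(p, n)) (b : 'cV[R]_n) (d : nat) :
  is_index A b C d -> (A + G *m C) ^+ d.-1 *m b = A ^+ d.-1 *m b.
Proof. by case=> _ zC _; apply: output_injection_pow. Qed.

Lemma col_fault_matrix (n p q : nat) (A : 'M[R]_n) (L : 'M[R]_(n, q))
    (C : 'M[R]_(p, n)) (d : 'I_q -> nat) (i : 'I_q) :
  col i (fault_matrix A L C d) = C *m A ^+ (d i).-1 *m col i L.
Proof. by apply/colP => k; rewrite !mxE. Qed.

Lemma markov_mem_output (n p : nat) (A : 'M[R]_n) (G : 'M[R]_(n, p))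
    (C : 'M[R]_(p, n)) (b : 'cV[R]_n) (d : nat) (V : {vspace 'cV[R]_n}) :
  smallest_invariant (A + G *m C) (limg (mxact b)) V -> is_index A b C d ->
  C *m A ^+ d.-1 *m b \in (mxact C @: V)%VS.
Proof.
move=> sV /(output_injection_index G) Eb.
rewrite -mulmxA -Eb -mxactE; apply: memv_img.
exact: mem_smallest_invariant sV.
Qed.

(** In a vanishing combination of the columns, the [i]-th term lies in [W i] and equals minus the
    sum of the others. Independence makes it zero, and [col i M] being nonzero kills its
    coefficient. *)
Lemma independent_family_rank (p q : nat) (W : 'I_q -> {vspace 'cV[R]_p})
    (M : 'M[R]_(p, q)) :
  independent_family W -> (forall i, col i M \in W i) ->
  (forall i, col i M <> 0) -> \rank M = q.
Proof.
move=> indW MW nzM; rewrite -mxrank_tr; apply/eqP.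
rewrite -[_ == _]/(row_free M^T) -kermx_eq0; apply/rowV0P => x /sub_kermxP xM0.
apply/rowP => i; rewrite mxE.
have sum0 : \sum_j x 0 j *: col j M = 0.
  apply/colP => k; have := congr1 (fun y : 'rV_p => y 0 k) xM0; rewrite !mxE.
  by move=> E; rewrite -[RHS]E summxE; apply: eq_bigr => j _; rewrite !mxE.
have : x 0 i *: col i M \in (W i :&: \sum_(j < q | j != i) W j)%VS.
  rewrite memv_cap rpredZ //=; move: sum0; rewrite (bigD1 i) //=.
  move/eqP; rewrite addr_eq0 => /eqP->; rewrite rpredN.
  by apply: memv_sumr => j _; rewrite rpredZ.
rewrite (indW i).2 memv0 scaler_eq0 => /orP[/eqP //|/eqP /nzM []].
Qed.

End OutputInjection.

Theorem theorem2 (R : realType) (n p q : nat)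
    (A : 'M[R]_n) (L : 'M[R]_(n, q)) (C : 'M[R]_(p, n)) :
  FDI_solvable A L C <->
  exists d : 'I_q -> nat,
    (forall i : 'I_q, is_index A (col i L) C (d i)) /\
    \rank (fault_matrix A L C d) = q.
Proof.
split.
  move=> [G [V [sV indV]]].
  have /fin_all_exists[d dP] : forall i, exists d, is_index A (col i L) C d.
    (* If all Markov parameters vanished, the orbit of [col i L] would stay in the kernel of [C],
       forcing [C V_i = 0]. *)
    move=> i; apply: index_exists => zC; case: (indV i).1.
    apply/eqP; rewrite -subv0; apply/subvP => _ /memv_imgP[u uV ->].
    have : u \in lker (mxact C).
      apply: (subvP (smallest_invariant_sub_orbit (sV i) _)) uV => k.
      by rewrite memv_ker output_injection_pow // mxactE mulmxA zC.
    by rewrite memv_ker memv0.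
  exists d; split=> //; apply: independent_family_rank indV _ _ => i.
    by rewrite col_fault_matrix; apply: markov_mem_output (sV i) (dP i).
  by rewrite col_fault_matrix; case: (dP i).
move=> [d [dP rF]]; set F := fault_matrix A L C d in rF.
have /row_fullP[Q QF] : row_full F by rewrite /row_full rF.
pose G := - (\matrix_(k, j) (A ^+ d j *m col j L) k 0) *m Q.
have GF i : G *m col i F = - (A ^+ d i *m col i L).
  rewrite /G colE -!mulmxA [Q *m _]mulmxA QF mul1mx mulNmx -colE.
  by congr (- _); apply/colP => k; rewrite !mxE.
have /fin_all_exists[V sV] :
    forall i, exists V, smallest_invariant (A + G *m C) (limg (mxact (col i L))) V.
  by move=> i; apply: smallest_invariant_exists.
exists G, V; split=> //.
have Vline i : (mxact C @: V i <= <[col i F]>)%VS.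
  have [d_gt0 zC _] := dP i.
  (* The power [(d i).-1] still agrees with that of [A]; the next application adds [G *m col i F],
     chosen to cancel [A ^+ d i *m col i L]. *)
  have Md0 : (A + G *m C) ^+ d i *m col i L = 0.
    rewrite -(prednK d_gt0) exprS -mulmxE -mulmxA.
    rewrite (output_injection_index G (dP i)) mulmxDl -mulmxA [C *m _]mulmxA.
    by rewrite -col_fault_matrix GF mulmxA mulmxE -exprS prednK // subrr.
  apply/subvP => _ /memv_imgP[u uV ->]; rewrite memv_preim.
  apply: (subvP (smallest_invariant_sub_orbit (sV i) _)) uV => k.
  (* Along the orbit the output is zero for [k] below [(d i).-1], equals [col i F] at [(d i).-1],
     and is zero again from [d i] on. *)
  rewrite -memv_preim mxactE; have [ltkd|ledk] := ltnP k (d i); last first.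
    by rewrite -(subnK ledk) exprD -mulmxE -mulmxA Md0 !mulmx0 mem0v.
  have lekd : (k <= (d i).-1)%N by rewrite -ltnS prednK.
  rewrite output_injection_pow; last by move=> j /leq_trans/(_ lekd)/zC.
  rewrite mulmxA; move: lekd; rewrite leq_eqVlt => /orP[/eqP->|/zC->].
    by rewrite -col_fault_matrix memv_line.
  exact: mem0v.
move=> i; split.
  move=> V0; have := markov_mem_output (sV i) (dP i).
  by rewrite V0 memv0 => /eqP; case: (dP i).
apply/eqP; rewrite -subv0; apply/subvP => v; rewrite memv_cap => /andP[vi vs].
(* The rows of [Q] are dual to the columns of [F]: the functional [row i Q] kills every [C V_j] with
   [j != i], yet reads off the coefficient of [v] on [col i F]. *)
have Qcol j : row i Q *m col j F = (i == j)%:R%:M.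
  apply/matrixP => a b; rewrite !ord1 colE mulmxA -row_mul QF -colE !mxE.
  by rewrite eqxx mulr1n.
have sker : (\sum_(j < q | j != i) mxact C @: V j <= lker (mxact (row i Q)))%VS.
  apply/subv_sumP => j ji; apply: subv_trans (Vline j) _.
  by rewrite -memvE memv_ker mxactE Qcol [i == j]eq_sym (negbTE ji) raddf0.
have /vlineP[a va] := subvP (Vline i) _ vi.
have := subvP sker _ vs; rewrite memv_ker mxactE va -scalemxAr Qcol eqxx.
rewrite scale_scalar_mx mulr1 => /eqP /matrixP /(_ 0 0).
by rewrite !mxE mulr1n => ->; rewrite scale0r mem0v.
Qed.
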